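(* Let $D'$ be a bidirected quarter-grid or a cyclic quarter-grid. Then all out-rays contained in $D'$ are pairwise equivalent in $D'$. Furthermore, there is no in-ray in $D'$.
   Context: $\mathbb N=\{1,2,\dots\}$. Paths in digraphs are finite and directed. For vertex sets or subgraphs $A,B$, an $A$–$B$ path is a path that starts in $A$, ends in $B$ and has no inner vertex in $A\cup B$. An out-ray (in-ray) is a digraph whose underlying undirected graph is a ray (one-way infinite path) and whose edges are all oriented away from (towards) its unique vertex of degree $1$, its root. Two out- or in-rays $R,R'$ of a digraph are equivalent if the digraph contains infinitely many pairwise disjoint $R$–$R'$ paths and infinitely many pairwise disjoint $R'$–$R$ paths. Quarter-grids. Let $(R_i)_{i\in\mathbb N}$ be pairwise disjoint out-rays. For a vertex set $X$ let $\lceil X\rceil$ be the union of $X$ and the set of all vertices $v$ lying on some $R_i$ such that the subray of $R_i$ with root $v$ contains a vertex of $X$; for a subgraph $G$ put $\lceil G\rceil:=\lceil V(G)\rceil$. For a sequence $i_1,\dots,i_n$ of indices ($n\ge 2$), a simple $i_1,\dots,i_n$-staircase is a path that is the concatenation of $P_1,Q_2,P_2,Q_3,\dots,Q_{n-1},P_{n-1}$, each consisting of exactly one edge, where $P_j$ is an edge from $R_{i_j}$ to $R_{i_{j+1}}$ and $Q_j$ is an edge of $R_{i_j}$ from the end vertex of $P_{j-1}$ to the start vertex of $P_j$. A digraph $D'=\bigcup_{i\in\mathbb N}R_i\cup\bigcup_{n\ge2}G_n$ is considered, where the digraphs $G_n$ (the girders) satisfy: $G_n$ avoids $\lceil G_i\rceil$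 for all $2\le i<n$; $D'$ has no vertex whose in-degree and out-degree are both one; the first vertex of each $R_i$ lies in no $G_n$. - $D'$ is a bidirected quarter-grid if, for every $n\ge2$, $G_n$ is the concatenation of a simple $1,2,\dots,n$-staircase $S_n'$, an edge of $R_n$ and a simple $n,n-1,\dots,1$-staircase $S_n''$ such that $S_n''$ avoids $\lceil S_n'\rceil$. - $D'$ is an ascending cyclic quarter-grid if, for every $n\ge 2$, $G_n$ is the concatenation of a simple $1,2,\dots,n$-staircase $S_n$, an edge of $R_n$ and an edge $A_n$ from $R_n$ to $R_1$ such that $A_n$ avoids $\lceil S_n\rceil$. - $D'$ is a descending cyclic quarter-grid if, for every $n\ge2$, $G_n$ is the concatenation of an edge $A_n$ from $R_1$ to $R_n$, an edge of $R_n$ and a simple $n,n-1,\dots,1$-staircase $S_n$ such that $S_n$ avoids $\lceil A_n\rceil$. A cyclic quarter-grid is an ascending or a descending cyclic quarter-grid. *)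

(* Defs.v *)
From HB Require Import structures.
From mathcomp Require Import all_boot.
From mathcomp Require Import boolp classical_sets functions cardinality.

Set Implicit Arguments.
Unset Strict Implicit.
Unset Printing Implicit Defensive.

Local Open Scope classical_set_scope.

(* All digraphs under consideration have their vertices in a common ambient
   type V, so that unions, subdigraphs and disjointness make sense.  Digraphs
   are simple: an arc is an ordered pair of vertices. *)
Record digraph (V : Type) := Digraph {
  verts : set V;
  arcs : V -> V -> Prop;
  arcs_verts : forall u v, arcs u v -> verts u /\ verts v }.

Section Digraphs.
Variable V : Type.
Implicit Types (D H R : digraph V) (A B X : set V).

Definition subdigraph H D : Prop :=
  verts H `<=` verts D /\ forall u v, arcs H u v -> arcs D u v.

Definition bigunion_verts (I : Type) (J : set I) (F : I -> digraph V) : set V :=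
  \bigcup_(i in J) verts (F i).

Definition bigunion_arcs (I : Type) (J : set I) (F : I -> digraph V) (u v : V) :
  Prop := exists2 i, J i & arcs (F i) u v.

Lemma bigunion_arcs_verts (I : Type) (J : set I) (F : I -> digraph V) u v :
  bigunion_arcs J F u v -> bigunion_verts J F u /\ bigunion_verts J F v.
Proof. by move=> [i Ji uv]; have [Hu Hv] := arcs_verts uv; split; exists i. Qed.

Definition bigunion (I : Type) (J : set I) (F : I -> digraph V) : digraph V :=
  Digraph (@bigunion_arcs_verts I J F).

Lemma union_arcs_verts D H u v :
  arcs D u v \/ arcs H u v ->
  (verts D `|` verts H) u /\ (verts D `|` verts H) v.
Proof. by case=> uv; have [Hu Hv] := arcs_verts uv; split; by [left|right]. Qed.

Definition union D H : digraph V := Digraph (@union_arcs_verts D H).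

Definition in_degree_one D v : Prop := ([set u | arcs D u v] #= `I_1)%card.
Definition out_degree_one D v : Prop := ([set u | arcs D v u] #= `I_1)%card.

Definition avoids A B : Prop := A `&` B = set0.

Definition underlying_edge D (u v : V) : Prop := arcs D u v \/ arcs D v u.

(* The underlying undirected graph of R is the ray  f 0 - f 1 - f 2 - ... ;
   its unique vertex of degree 1 is f 0. *)
Definition underlying_ray R (f : nat -> V) : Prop :=
  [/\ injective f, verts R = range f &
      forall u v, underlying_edge R u v <->
        exists k, (u = f k /\ v = f k.+1) \/ (u = f k.+1 /\ v = f k)].

Definition out_ray_rooted R (r : V) : Prop :=
  exists f, [/\ underlying_ray R f, f 0 = r &
    forall u v, arcs R u v -> exists k, u = f k /\ v = f k.+1].

Definition in_ray_rooted R (r : V) : Prop :=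
  exists f, [/\ underlying_ray R f, f 0 = r &
    forall u v, arcs R u v -> exists k, u = f k.+1 /\ v = f k].

Definition out_ray R : Prop := exists r, out_ray_rooted R r.
Definition in_ray R : Prop := exists r, in_ray_rooted R r.

End Digraphs.

Section Paths.
Variable V : eqType.
Implicit Types (D R : digraph V) (A B X : set V).

(* A path is a nonempty duplicate-free sequence of vertices; its arcs are the
   pairs of consecutive entries.  One-vertex paths are allowed. *)
Lemma path_arcs_verts (s : seq V) u v :
  infix [:: u; v] s -> [set` s] u /\ [set` s] v.
Proof. by move=> uv; split; apply: (mem_infix uv); rewrite !inE eqxx ?orbT. Qed.

Definition path_digraph (s : seq V) : digraph V :=
  Digraph (@path_arcs_verts s).

(* x :: p is an A-B path of D *)
Definition AB_path D A B (x : V) (p : seq V) : Prop :=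
  [/\ uniq (x :: p), subdigraph (path_digraph (x :: p)) D, A x, B (last x p) &
      forall v, v \in x :: p -> v != x -> v != last x p -> ~ (A `|` B) v].

Definition infinitely_many_disjoint_paths D A B : Prop :=
  exists PP : set (seq V),
    [/\ infinite_set PP,
        forall s, PP s -> exists x p, s = x :: p /\ AB_path D A B x p &
        trivIset PP (fun s => [set` s])].

Definition equivalent_rays D R R' : Prop :=
  infinitely_many_disjoint_paths D (verts R) (verts R') /\
  infinitely_many_disjoint_paths D (verts R') (verts R).

End Paths.

Section QuarterGrids.
Variable V : eqType.
Implicit Types (D : digraph V) (X : set V) (s : seq V).
(* The rays R i are used for 1 <= i, the girders G n for 2 <= n. *)
Implicit Types R G : nat -> digraph V.

Definition ceil R X : set V :=
  X `|` [set v | exists i, [/\ 1 <= i, verts (R i) v &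
    exists T, [/\ subdigraph T (R i), out_ray_rooted T v &
                  verts T `&` X !=set0]]].

(* s is the vertex sequence a_1 b_1 a_2 b_2 ... a_(n-1) b_(n-1) of a simple
   (i 1), ..., (i n)-staircase:  P_j is the edge from a_j to b_j and Q_j the
   edge from b_(j-1) to a_j. *)
Definition simple_staircase R (n : nat) (i : nat -> nat) s : Prop :=
  exists a b : nat -> V,
    [/\ s = flatten [seq [:: a j; b j] | j <- iota 1 n.-1],
        uniq s,
        forall j, 1 <= j < n -> verts (R (i j)) (a j) /\ verts (R (i j.+1)) (b j) &
        forall j, 2 <= j < n -> arcs (R (i j)) (b j.-1) (a j)].

Definition ascending_staircase R n s : Prop :=
  simple_staircase R n (fun j => j) s.

Definition descending_staircase R n s : Prop :=
  simple_staircase R n (fun j => n.+1 - j) s.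

Definition rays_and_girders R G D : Prop :=
  [/\ forall i, 1 <= i -> out_ray (R i),
      trivIset [set i | 1 <= i] (fun i => verts (R i)),
      D = union (bigunion [set i | 1 <= i] R) (bigunion [set n | 2 <= n] G),
      forall i n, 2 <= i < n -> avoids (verts (G n)) (ceil R (verts (G i))) &
      (forall v, verts D v -> ~ (in_degree_one D v /\ out_degree_one D v)) /\
      (forall i n r, 1 <= i -> 2 <= n -> out_ray_rooted (R i) r ->
         ~ verts (G n) r)].

Definition bidirected_girder R n (H : digraph V) : Prop :=
  exists (s : seq V) (x y : V) (t : seq V),
    [/\ H = path_digraph (rcons s x ++ y :: t),
        ascending_staircase R n (rcons s x),
        arcs (R n) x y,
        descending_staircase R n (y :: t) &
        avoids [set` y :: t] (ceil R [set` rcons s x])].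

(* the final edge A_n is (y, z) *)
Definition ascending_girder R n (H : digraph V) : Prop :=
  exists (s : seq V) (x y z : V),
    [/\ H = path_digraph (rcons s x ++ [:: y; z]),
        ascending_staircase R n (rcons s x),
        arcs (R n) x y,
        verts (R n) y /\ verts (R 1) z &
        avoids [set` [:: y; z]] (ceil R [set` rcons s x])].

(* the initial edge A_n is (x, y) *)
Definition descending_girder R n (H : digraph V) : Prop :=
  exists (x y z : V) (t : seq V),
    [/\ H = path_digraph ([:: x; y] ++ z :: t),
        verts (R 1) x /\ verts (R n) y,
        arcs (R n) y z,
        descending_staircase R n (z :: t) &
        avoids [set` z :: t] (ceil R [set` [:: x; y]])].

Definition bidirected_quarter_grid D : Prop :=
  exists R G, rays_and_girders R G D /\
    forall n, 2 <= n -> bidirected_girder R n (G n).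

Definition ascending_cyclic_quarter_grid D : Prop :=
  exists R G, rays_and_girders R G D /\
    forall n, 2 <= n -> ascending_girder R n (G n).

Definition descending_cyclic_quarter_grid D : Prop :=
  exists R G, rays_and_girders R G D /\
    forall n, 2 <= n -> descending_girder R n (G n).

Definition cyclic_quarter_grid D : Prop :=
  ascending_cyclic_quarter_grid D \/ descending_cyclic_quarter_grid D.

End QuarterGrids.

(* Main.v *)
(* Give a vertex level n if it lies in the girder G_n, and level 0 if it lies in
   no girder.  The degree condition forces every vertex with an incoming arc into
   some girder, and since G_n avoids the down-closure of the earlier girders, the
   level never decreases along an arc.  Each positive level is finite, so out-rays
   have unbounded level, while an in-ray would have bounded level and hence
   cannot exist.  Every girder starts and ends on R_1, so from a vertex of level
   n one reaches any vertex of level m > n: follow G_n to its end, then R_1 to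
   the start of G_m, then G_m.  All levels on that walk lie between n and m, so
   walks using disjoint windows of levels are disjoint. *)

Require Import Defs.
From mathcomp Require Import all_boot.
From mathcomp Require Import boolp classical_sets functions cardinality.

Set Implicit Arguments.
Unset Strict Implicit.
Unset Printing Implicit Defensive.

Local Open Scope classical_set_scope.

(** * Walks, the paths extracted from them, and disjointness via levels *)

Section Walks.
Variable V : eqType.
Implicit Types (D : digraph V) (A B : set V).

Definition arcb D : rel V := fun u v => `[< arcs D u v >].

Lemma arcbP D u v : reflect (arcs D u v) (arcb D u v).
Proof. exact: asboolP. Qed.

Lemma path_digraph_walk D x p :
  subdigraph (path_digraph (x :: p)) D -> path (arcb D) x p.
Proof.
case=> _; elim: p x => [//|y p IHp] x sub /=; apply/andP; split.
  by apply/arcbP/sub/infixP; exists [::], p.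
apply: IHp => u v /infixP[s1 [s2 eq_p]].
by apply/sub/infixP; exists (x :: s1), s2; rewrite /= eq_p.
Qed.

Lemma walk_path_digraph D x p :
  verts D x -> path (arcb D) x p -> subdigraph (path_digraph (x :: p)) D.
Proof.
move=> Dx xp; split => [v /=|u v /infixP[s1 [s2]]].
  elim: p x Dx xp => [|y p IHp] x Dx /=; first by rewrite inE => _ /eqP->.
  case/andP=> /arcbP xy yp; have [_ Dy] := arcs_verts xy.
  by rewrite inE => /predU1P[->//|]; apply: IHp.
case: s1 => [|a s1] /= [eq_x eq_p]; move: xp; rewrite eq_p.
  by rewrite /= eq_x => /andP[/arcbP].
by rewrite cat_path /= => /and3P[_ _ /andP[/arcbP]].
Qed.

(** Make the walk duplicate-free, then shorten it: an inner vertex in [A] becomes the new start, one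
    in [B] the new end. No vertex is ever added, so lower bounds on levels survive. *)
Lemma walk_AB_path D A B x p :
  verts D x -> path (arcb D) x p -> A x -> B (last x p) ->
  exists y q, AB_path D A B y q /\ {subset y :: q <= x :: p}.
Proof.
move=> Dx xp Ax; case: (shortenP xp) => p' xp' Up' subp' Bp'.
suff [y [q [ABq sub]]]: exists y q, AB_path D A B y q /\ {subset y :: q <= x :: p'}.
  exists y, q; split=> // v /sub; rewrite !inE => /predU1P[->|/subp' ->].
    by rewrite eqxx.
  by rewrite orbT.
have [n le_p] := ubnPleq (size p'); move: le_p => {p xp subp'}le_p.
elim: n p' le_p x Dx xp' Up' Ax Bp' => [|n IHn] p le_p x Dx xp Up Ax Bp.
  case: p le_p xp Up Bp => // _ _ _ Bx.
  exists x, [::]; split=> //; split=> //; first exact: walk_path_digraph.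
  by move=> v; rewrite inE => /eqP->; rewrite eqxx.
have [nAB|] := pselect (forall v, v \in x :: p -> v != x -> v != last x p ->
  ~ (A `|` B) v).
  by exists x, p; split=> //; split=> //; apply: walk_path_digraph.
move/existsNP=> [v /not_implyP[xpv /not_implyP[nvx /not_implyP[nvl]]]] /contrapT ABv.
move: xpv; rewrite inE (negPf nvx) /= => pv.
case: ABv => [Av|Bv].
  case/splitPr: pv le_p xp Up Bp nvl => p1 p2.
  rewrite -cat_cons cat_uniq size_cat addnS ltnS cat_path last_cat.
  move=> le_p /and3P[_ /arcbP/(@arcs_verts _ D)[_ Dv] vp2] /and3P[_ _ Up2] Bp _.
  have [|y [q [ABq sub]]] := IHn p2 _ v Dv vp2 Up2 Av Bp.
    by apply: leq_trans le_p; apply: leq_addl.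
  by exists y, q; split=> // w /sub; rewrite mem_cat => ->; rewrite orbT.
case/path.splitP: pv le_p xp Up Bp nvl => p1 p2.
rewrite size_cat cat_path -cat_cons cat_uniq last_cat last_rcons.
(* An empty [p2] would make [v] the last vertex, so cutting after [v] strictly shortens the path. *)
case: p2 => [|w p2]; first by rewrite eqxx.
rewrite addnS ltnS => le_p /andP[xp1 _] /andP[Up1 _] _ _.
have [||y [q [ABq sub]]] := IHn (rcons p1 v) _ x Dx xp1 Up1 Ax.
- by apply: leq_trans le_p; apply: leq_addr.
- by rewrite last_rcons.
by exists y, q; split=> // u /sub; rewrite mem_cat => ->.
Qed.

Lemma infinitely_many_disjoint_paths_of_levels (lev : V -> nat) D A B :
  (forall N, exists x p,
     AB_path D A B x p /\ {in x :: p, forall v, N < lev v}) ->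
  infinitely_many_disjoint_paths D A B.
Proof.
move=> pathN.
have /choice[F FP] N : exists s, (exists x p, s = x :: p /\ AB_path D A B x p)
    /\ {in s, forall v, N < lev v}.
  by have [x [p [ABp Np]]] := pathN N; exists (x :: p); split=> //; exists x, p.
(* The next threshold is the top level of the path just chosen, so [P i] lives in the window
   [K i < lev v <= K i.+1]. These windows are disjoint; as no path is empty, the paths are also
   distinct. *)
pose h N := \max_(v <- F N) lev v.
pose K i := iter i h 0; pose P i := F (K i).
have Plev i v : v \in P i -> K i < lev v <= K i.+1.
  by move=> Pv; rewrite (FP (K i)).2 //=; apply: (leq_bigmax_seq v).
have P0 i : exists v, v \in P i.
  by have [[x [p [eqF _]]] _] := FP (K i); exists x; rewrite /P eqF mem_head.
have Kmono : {homo K : i j / i <= j}.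
  apply: homo_leq => // [? ? ?|i]; first exact: leq_trans.
  by have [v /Plev/andP[lo hi]] := P0 i; apply: leq_trans (ltnW lo) hi.
have Plt i j v : i < j -> v \in P i -> v \in P j -> False.
  move=> /Kmono Kij /Plev/andP[_ hi] /Plev/andP[lo _].
  by have := leq_ltn_trans (leq_trans hi Kij) lo; rewrite ltnn.
have Pinj : injective P.
  move=> i j eqP; have [v Pv] := P0 i.
  by case: (ltngtP i j) => // /Plt/(_ (_ : v \in _) _); case; rewrite // ?eqP // -eqP.
exists (range P); split.
- by rewrite (eq_finite_set (inj_card_eq (in2W Pinj))); apply: infinite_nat.
- by move=> _ [i _ <-]; have [] := FP (K i).
- rewrite -(trivIset_comp (fun s => [set` s]) (in2W Pinj)).
  apply: ltn_trivIset => i j ji; apply/seteqP; split=> // v [/= Pi Pj].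
  exact: (Plt j i v).
Qed.
End Walks.

(** * Enumerated rays and down-closures *)

Section Rays.
Variable V : eqType.
Implicit Types (R T : digraph V) (f : nat -> V).

Definition out_ray_enum R f : Prop :=
  [/\ injective f, verts R = range f &
      forall u v, arcs R u v <-> exists k, u = f k /\ v = f k.+1].

Definition in_ray_enum R f : Prop :=
  [/\ injective f, verts R = range f &
      forall u v, arcs R u v <-> exists k, u = f k.+1 /\ v = f k].

Lemma out_ray_rooted_enum R r :
  out_ray_rooted R r <-> exists2 f, out_ray_enum R f & f 0 = r.
Proof.
split=> [[f [[f_inj Rf edgeP] f0 arcR]]|[f [f_inj Rf arcP] f0]]; exists f => //.
  split=> // u v; split=> [/arcR//|[k [-> ->]]].
  (* The edge is oriented one way or the other; the backward orientation would give [k.+1 = j] and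
     [k = j.+1]. *)
  have [_ /(_ (ex_intro _ k (or_introl (conj erefl erefl))))] := edgeP (f k) (f k.+1).
  by case=> // /arcR[j [/f_inj e1 /f_inj e2]]; have := leqnSn j; rewrite -e2 -e1 ltnn.
split=> //; last by move=> u v /arcP.
split=> // u v; split=> [[/arcP[k ?]|/arcP[k [? ?]]]|[k [?|[? ?]]]].
- by exists k; left.
- by exists k; right.
- by left; apply/arcP; exists k.
- by right; apply/arcP; exists k.
Qed.

Lemma in_ray_rooted_enum R r :
  in_ray_rooted R r -> exists2 f, in_ray_enum R f & f 0 = r.
Proof.
move=> [f [[f_inj Rf edgeP] f0 arcR]]; exists f => //.
split=> // u v; split=> [/arcR//|[k [-> ->]]].
have [_ /(_ (ex_intro _ k (or_introl (conj erefl erefl))))] := edgeP (f k) (f k.+1).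
by case=> // /arcR[j [/f_inj e1 /f_inj e2]]; have := leqnSn j; rewrite -e1 -e2 ltnn.
Qed.

(** The tail of [f] from index [k] on is the subray that [ceil] asks for. *)
Lemma ceil_ray (F : nat -> digraph V) (X : set V) i f k l :
  0 < i -> out_ray_enum (F i) f -> k <= l -> X (f l) -> ceil F X (f k).
Proof.
move=> i_gt0 [f_inj Ff arcP] kl Xl; right; exists i.
pose tail_arcs u v := exists j, u = f (k + j) /\ v = f (k + j.+1).
have tail_verts u v : tail_arcs u v ->
    range (fun j => f (k + j)) u /\ range (fun j => f (k + j)) v.
  by case=> j [-> ->]; split; [exists j|exists j.+1].
split=> //; first by rewrite Ff; exists k.
exists (Digraph tail_verts); split.
- split=> [_ [j _ <-]|_ _ [j [-> ->]]]; first by rewrite Ff; exists (k + j).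
  by apply/arcP; exists (k + j); rewrite addnS.
- apply/out_ray_rooted_enum; exists (fun j => f (k + j)); last by rewrite addn0.
  by split=> // i1 i2 /f_inj/addnI.
- by exists (f l); split=> //; exists (l - k); rewrite // subnKC.
Qed.

End Rays.

(** * Consequences of a level function that is monotone along arcs *)

Section Levels.
Variables (V : eqType) (D : digraph V) (lev : V -> nat).
Hypothesis lev_arc : forall u v, arcs D u v -> lev u <= lev v.
(** Restricted to heads of arcs, because in a grid the infinitely many ray roots all have level
    0. *)
Hypothesis lev_fin : forall N, exists s : seq V,
  forall u v, arcs D u v -> lev v <= N -> v \in s.
Hypothesis lev_walk : forall u v, 0 < lev u < lev v ->
  exists2 p, path (arcb D) u p & last u p = v.

Lemma level_unbounded (g : nat -> V) N :
  injective g -> (forall k, exists u, arcs D u (g k)) -> exists k, N < lev (g k).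
Proof.
move=> g_inj g_arc; apply: contrapT => /forallNP g_le.
have [s s_fin] := lev_fin N.
(* Pigeonhole: the first [(size s).+1] values of [g] are distinct, yet all would lie in [s]. *)
suff: size (map g (iota 0 (size s).+1)) <= size s.
  by rewrite size_map size_iota ltnn.
apply: uniq_leq_size => [|_ /mapP[k _ ->]]; first by rewrite map_inj_uniq ?iota_uniq.
by have [u ug] := g_arc k; apply: s_fin ug _; rewrite leqNgt; apply/negP/g_le.
Qed.

Lemma no_in_ray_of_levels : ~ exists R, in_ray R /\ subdigraph R D.
Proof.
move=> [R [[r /in_ray_rooted_enum[f [f_inj _ arcP] _]] [_ subR]]].
have f_arc k : arcs D (f k.+1) (f k) by apply/subR/arcP; exists k.
have [k|k] := @level_unbounded f (lev (f 0)) f_inj; first by exists (f k.+1).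
suff /(_ k) f_le n : lev (f n) <= lev (f 0) by rewrite ltnNge f_le.
by elim: n => // n; apply: leq_trans; apply: lev_arc.
Qed.

Lemma walk_level x p :
  path (arcb D) x p -> {in x :: p, forall v, lev x <= lev v}.
Proof.
elim: p x => [|y p IHp] x /= => [_ v|/andP[/arcbP xy yp] v].
  by rewrite mem_seq1 => /eqP->.
rewrite in_cons => /predU1P[->//|/IHp] le_y.
exact: leq_trans (lev_arc xy) (le_y yp).
Qed.

Lemma out_ray_unbounded R N : out_ray R -> subdigraph R D ->
  exists2 v, verts R v & N < lev v.
Proof.
move=> [r /out_ray_rooted_enum[f [f_inj Rf arcP] _]] [_ subR].
(* The shift drops the root, which need not have an incoming arc. *)
have [||k] := @level_unbounded (f \o S) N; first by move=> i j /= /f_inj [].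
  by move=> k; exists (f k); apply/subR/arcP; exists k.
by move=> Nk; exists (f k.+1); rewrite // Rf; exists k.+1.
Qed.

(** Pick [u] on one ray above level [N] and [v] on the other above [lev u]; a walk from [u] to [v]
    stays above [N] by monotonicity, and so does the path extracted from it. *)
Lemma equivalent_rays_of_levels R R' :
  out_ray R -> subdigraph R D -> out_ray R' -> subdigraph R' D ->
  equivalent_rays D R R'.
Proof.
suff paths S S' : out_ray S -> subdigraph S D -> out_ray S' -> subdigraph S' D ->
    infinitely_many_disjoint_paths D (verts S) (verts S').
  by move=> *; split; apply: paths.
move=> rayS subS rayS' subS'.
apply: (@infinitely_many_disjoint_paths_of_levels _ lev) => N.
have [u Su Nu] := out_ray_unbounded N rayS subS.
have [v S'v uv] := out_ray_unbounded (lev u) rayS' subS'.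
have [|p up last_p] := @lev_walk u v; first by rewrite uv (leq_ltn_trans _ Nu).
have [|y [q [ABq sub]]] := @walk_AB_path _ D (verts S) (verts S') u p (subS.1 _ Su) up Su.
  by rewrite last_p.
exists y, q; split=> // w /sub /(walk_level up); exact: leq_trans.
Qed.

End Levels.

(** * Levels in a grid whose girders start and end on [R 1] *)

Section Girders.
Variables (V : eqType) (R G : nat -> digraph V) (D : digraph V).
Hypothesis grid : rays_and_girders R G D.
Hypothesis girder_ends : forall n, 1 < n -> exists x p,
  [/\ G n = path_digraph (x :: p), verts (R 1) x & verts (R 1) (last x p)].

(** The default 0 is not a girder index; that the choice is unique follows from disjointness of the
    girders. *)
Definition level (v : V) : nat := xget 0 [set n | 1 < n /\ verts (G n) v].

Lemma ray_enum i : 0 < i -> exists f, out_ray_enum (R i) f.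
Proof.
by case: grid => rays _ _ _ _ /rays[r /out_ray_rooted_enum[f Rf _]]; exists f.
Qed.

Lemma ray_sub i : 0 < i -> subdigraph (R i) D.
Proof.
case: grid => _ _ -> _ _ i_gt0.
by split=> [v Rv|u v Ruv]; left; exists i.
Qed.

Lemma girder_sub n : 1 < n -> subdigraph (G n) D.
Proof.
case: grid => _ _ -> _ _ n_gt1.
by split=> [v Rv|u v Ruv]; right; exists n.
Qed.

Lemma girder_avoids m n v :
  1 < m < n -> verts (G n) v -> ~ ceil R (verts (G m)) v.
Proof.
case: grid => _ _ _ avoidG _ mn Gv Cv.
by have := avoidG m n mn; rewrite /avoids -subset0 => /(_ v (conj Gv Cv)).
Qed.

(** If [n < m], then [f k], preceding [f l] on the ray, would lie in the down-closure of [G n],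
    which [G m] avoids. *)
Lemma girder_le m n i f k l : 0 < i -> out_ray_enum (R i) f ->
  1 < m -> 1 < n -> verts (G m) (f k) -> verts (G n) (f l) -> k <= l -> m <= n.
Proof.
move=> i_gt0 Rf m_gt1 n_gt1 Gk Gl kl; rewrite leqNgt; apply/negP => nm.
have mn : 1 < n < m by rewrite n_gt1.
by apply: (girder_avoids mn Gk); apply: ceil_ray Rf kl Gl.
Qed.

Lemma level_girder n v : 1 < n -> verts (G n) v -> level v = n.
Proof.
move=> n_gt1 Gv; rewrite /level; case: xgetP => [m _ [m_gt1 Gmv]|/(_ n)[]//].
case: (ltngtP m n) => // [mn|nm].
  by case: (@girder_avoids m n v) => //; [rewrite m_gt1|left].
by case: (@girder_avoids n m v) => //; [rewrite n_gt1|left].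
Qed.

Lemma girder_level v : 0 < level v -> 1 < level v /\ verts (G (level v)) v.
Proof. by rewrite /level; case: xgetP. Qed.

(** Outside all girders, every arc at [v] belongs to the one ray through [v]. As [v] has a
    predecessor it is not the root, so both its degrees are one, which is forbidden. *)
Lemma in_arc_level u v : arcs D u v -> 0 < level v.
Proof.
move=> uv; apply: contrapT => /negP; rewrite -leqNgt leqn0 => /eqP lev0.
have notG n : 1 < n -> ~ verts (G n) v.
  by move=> n_gt1 /(level_girder n_gt1); rewrite lev0 => n0; rewrite -n0 in n_gt1.
case: grid => _ disj eqD _ [noDeg _].
have arc_ray a b : a = v \/ b = v -> arcs D a b -> exists2 i, 0 < i & arcs (R i) a b.
  rewrite eqD => abv [[i ? ?]|[n n2 Gab]]; first by exists i.
  by have [Ga Gb] := arcs_verts Gab; case: abv => e; case: (notG n n2); rewrite -e.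
have [i i_gt0 Ruv] := arc_ray u v (or_intror erefl) uv.
have [f [f_inj Rf arcP]] := ray_enum i_gt0.
have /arcP[k [eq_u eq_v]] := Ruv.
have Rv : verts (R i) v by case: (arcs_verts Ruv).
have same_ray j : 0 < j -> verts (R j) v -> j = i.
  by move=> j_gt0 Rjv; apply: disj => //; exists v.
apply: (noDeg v); first by case: (arcs_verts uv).
split.
- rewrite /in_degree_one (_ : [set a | _] = [set f k]) ?card_set1 //.
  apply/seteqP; split=> a /=; last by move=> ->; rewrite -eq_u.
  move=> av; have [j j_gt0 Rav] := arc_ray a v (or_intror erefl) av.
  have ji := same_ray j j_gt0 (arcs_verts Rav).2; rewrite {j}ji in j_gt0 Rav.
  by have /arcP[l [-> ]] := Rav; rewrite eq_v => /f_inj [->].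
- rewrite /out_degree_one (_ : [set a | _] = [set f k.+2]) ?card_set1 //.
  apply/seteqP; split=> a /=; last first.
    by move=> ->; apply/(ray_sub i_gt0).2/arcP; exists k.+1; rewrite eq_v.
  move=> va; have [j j_gt0 Rva] := arc_ray v a (or_introl erefl) va.
  have ji := same_ray j j_gt0 (arcs_verts Rva).1; rewrite {j}ji in j_gt0 Rva.
  by have /arcP[l []] := Rva; rewrite eq_v => /f_inj <- ->.
Qed.

(** A ray arc joins consecutive indices, so [girder_le] applies; a girder arc stays within one
    level. *)
Lemma level_arc u v : arcs D u v -> level u <= level v.
Proof.
move=> uv; have := in_arc_level uv => /girder_level[v_gt1 Gv].
case: (posnP (level u)) => [->//|/girder_level[u_gt1 Gu]].
case: grid uv => _ _ -> _ _ [[i i_gt0 Ruv]|[n n_gt1 Guv]].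
  have [f Rf] := ray_enum i_gt0; have [_ _ arcP] := Rf.
  have /arcP[k [eq_u eq_v]] := Ruv.
  rewrite {}eq_u in u_gt1 Gu *; rewrite {}eq_v in v_gt1 Gv *.
  exact: (girder_le i_gt0 Rf u_gt1 v_gt1 Gu Gv (leqnSn k)).
by have [Gnu Gnv] := arcs_verts Guv; rewrite !(level_girder n_gt1).
Qed.

Lemma level_fin N : exists s : seq V,
  forall u v, arcs D u v -> level v <= N -> v \in s.
Proof.
suff [s sG] : exists s : seq V, forall n v, 1 < n <= N -> verts (G n) v -> v \in s.
  exists s => u v uv vN; have /girder_level[v_gt1 Gv] := in_arc_level uv.
  by apply: sG Gv; rewrite v_gt1.
elim: N => [|N [s IHN]]; first by exists [::] => n v; case: n => [|[]].
case: (ltnP 1 N.+1) => [/girder_ends[x [p [GN _ _]]]|N1]; last first.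
  by exists [::] => n v /andP[n1 /(leq_trans n1)]; rewrite ltnNge N1.
exists (x :: p ++ s) => n v; rewrite [n <= _]leq_eqVlt andb_orr => /orP[/andP[_ /eqP->]|nN].
  by rewrite GN /= -cat_cons mem_cat => ->.
by move=> Gv; rewrite -cat_cons mem_cat (IHN n v) ?orbT.
Qed.

Lemma ray_walk i f k l : 0 < i -> out_ray_enum (R i) f -> k <= l ->
  exists2 p, path (arcb D) (f k) p & last (f k) p = f l.
Proof.
move=> i_gt0 [_ _ arcP] /subnKC <-; elim: (l - k) => [|d [p kp last_p]].
  by exists [::]; rewrite ?addn0.
exists (rcons p (f (k + d.+1))); last by rewrite last_rcons.
rewrite rcons_path kp last_p addnS; apply/arcbP/(ray_sub i_gt0).2/arcP.
by exists (k + d).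
Qed.

Lemma level_walk u v : 0 < level u < level v ->
  exists2 p, path (arcb D) u p & last u p = v.
Proof.
move=> /andP[u_gt0 uv]; have [u_gt1 Gu] := girder_level u_gt0.
have [v_gt1 Gv] := girder_level (ltn_trans u_gt0 uv).
have [f Rf] := ray_enum (leqnn 1); have [_ R1 _] := Rf.
have [x [p [GuE _]]] := girder_ends u_gt1; rewrite R1 => -[k _ fk].
have [y [q [GvE]]] := girder_ends v_gt1; rewrite R1 => -[l _ fl] _.
have xp := girder_sub u_gt1; rewrite GuE in Gu xp; move/path_digraph_walk: xp => xp.
have yq := girder_sub v_gt1; rewrite GvE in Gv yq; move/path_digraph_walk: yq => yq.
(* On [R 1] the end of the lower girder comes no later than the start of the higher one, by
   [girder_le]. *)
have kl : k <= l.
  rewrite leqNgt; apply/negP => /ltnW lk.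
  have := girder_le (leqnn 1) Rf v_gt1 u_gt1 _ _ lk; rewrite GuE GvE fl fk leqNgt uv.
  by rewrite /= mem_head mem_last => /(_ isT isT).
have [s ks last_s] := ray_walk (leqnn 1) Rf kl; rewrite fk fl in ks last_s.
(* Keep [p2], the part of the lower girder after [u], and later [q1], the part of the higher girder
   up to [v]; the ray segment [s] joins them. *)
case/splitPl: Gu xp ks last_s => p1 p2 last_p1.
rewrite cat_path last_cat last_p1 => /andP[_ up2] ks last_s.
case/splitPl: Gv yq => q1 q2 last_q1; rewrite cat_path => /andP[yq1 _].
exists (p2 ++ s ++ q1); last by rewrite !last_cat last_s.
by rewrite !cat_path up2 ks last_s.
Qed.

Lemma quarter_grid_rays :
  (forall S S', out_ray S -> subdigraph S D -> out_ray S' -> subdigraph S' D ->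
     equivalent_rays D S S') /\ ~ (exists S, in_ray S /\ subdigraph S D).
Proof.
split; last exact: no_in_ray_of_levels level_arc level_fin.
exact: equivalent_rays_of_levels level_arc level_fin level_walk.
Qed.

End Girders.

(** * Ends of staircases, and the three kinds of grid *)

Lemma staircase_ends (V : eqType) (R : nat -> digraph V) n i s :
  1 < n -> simple_staircase R n i s ->
  exists x p, [/\ s = x :: p, verts (R (i 1)) x & verts (R (i n)) (last x p)].
Proof.
case: n => [|[|n]] // _ [a [b [-> _ Rab _]]] /=.
exists (a 1), (b 1 :: flatten [seq [:: a j; b j] | j <- iota 2 n]); split=> //.
  by have [] := Rab 1 isT.
(* The staircase now has [n.+2] rays, so its final edge has index [n.+1]. *)
rewrite /=; have -> : last (b 1) (flatten [seq [:: a j; b j] | j <- iota 2 n]) = b n.+1.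
  case: n {Rab} => // n.
  by rewrite -[X in iota _ X]addn1 iotaD map_cat flatten_cat last_cat.
by have [] := Rab n.+1; rewrite ?ltnS ?leqnn.
Qed.

Theorem proposition2p4 (V : eqType) (D : digraph V) :
  bidirected_quarter_grid D \/ cyclic_quarter_grid D ->
  (forall R R' : digraph V,
     out_ray R -> subdigraph R D -> out_ray R' -> subdigraph R' D ->
     equivalent_rays D R R') /\
  ~ (exists R : digraph V, in_ray R /\ subdigraph R D).
Proof.
case=> [|[]] [R [G [grid girder]]]; apply: (quarter_grid_rays grid) => n n_gt1.
- have [s [x [y [t [-> asc _ desc _]]]]] := girder n n_gt1.
  have [x0 [p [-> R1 _]]] := staircase_ends n_gt1 asc.
  have [_ [_ [[<- <-] _]]] := staircase_ends n_gt1 desc.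
  (* The descending staircase ends on the ray of index [n.+1 - n = 1]. *)
  rewrite subSnn => Rlast; exists x0, (p ++ y :: t); split=> //.
  by rewrite last_cat.
- have [s [x [y [z [-> asc _ [_ Rz] _]]]]] := girder n n_gt1.
  have [x0 [p [-> R1 _]]] := staircase_ends n_gt1 asc.
  by exists x0, (p ++ [:: y; z]); split=> //; rewrite last_cat.
- have [x [y [z [t [-> [Rx _] _ desc _]]]]] := girder n n_gt1.
  have [_ [_ [[<- <-] _]]] := staircase_ends n_gt1 desc.
  by rewrite subSnn => Rlast; exists x, (y :: z :: t); split.
Qed.
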